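(* Let $\mathcal{D}$ be a finite structure with domain $D$, and let $U,X,U',X'\subseteq D$ be such that both pairs $(U,X)$ and $(U',X')$ are selected as in the definition of a $U$-$X$-core of $\mathcal{D}$, with $U\cup X=D=U'\cup X'$ (so $\mathcal{D}$ is both a $U$-$X$-core and a $U'$-$X'$-core of itself). Then $U=U'$ and $X=X'$.
   Context: Structures are finite relational structures with nonempty domain. A shop of $D$ is a map $f$ from $D$ to the power set of $D$ with $f(d)\neq\emptyset$ for all $d$ and $\bigcup_d f(d)=D$; it is a surjective hyper-endomorphism of $\mathcal{D}$ if for each relation $R$ of arity $i$, $R(a_1,\dots,a_i)$ in $\mathcal{D}$ implies $R(b_1,\dots,b_i)$ in $\mathcal{D}$ for all $b_j\in f(a_j)$. $f(S)=\bigcup_{s\in S}f(s)$; $f$ is $U$-surjective if $f(U)=D$ and $X$-total if $f(d)\cap X\neq\emptyset$ for all $d$. Selection of $(U,X)$ for a $U$-$X$-core: $U$ has minimum cardinality among subsets $U''$ for which a $U''$-surjective surjective hyper-endomorphism of $\mathcal{D}$ exists, $X$ has minimum cardinality among subsets $X''$ for which an $X''$-total surjective hyper-endomorphism exists, and among all such choices $|U\cap X|$ is maximum; the substructure induced by $U\cup X$ is then a $U$-$X$-core of $\mathcal{D}$. *)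

(* Defs.v *)
From mathcomp Require Import all_boot.
Set Implicit Arguments.
Unset Strict Implicit.
Unset Printing Implicit Defensive.

Record signature := Signature { symbol : Type; arity : symbol -> nat }.

Record structure (S : signature) := Structure {
  domain :> finType;
  domain_nonempty : 0 < #|domain|;
  interp : forall R : symbol S, {set (arity R).-tuple domain}
}.

Section HyperEndomorphisms.
Variables (S : signature) (D : structure S).
Implicit Types (f : D -> {set D}) (U X : {set D}).

Definition hyper_image f (A : {set D}) : {set D} := \bigcup_(a in A) f a.

Definition shop f : Prop :=
  (forall d, f d != set0) /\ hyper_image f [set: D] = [set: D].

Definition surjective_hyper_endomorphism f : Prop :=
  shop f /\
  forall (R : symbol S) (a b : (arity R).-tuple D),
    a \in interp D R -> (forall j, tnth b j \in f (tnth a j)) ->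
    b \in interp D R.

Definition surjective_from U f : Prop := hyper_image f U = [set: D].

Definition total_into X f : Prop := forall d, f d :&: X != set0.

Definition admits_surjective U : Prop :=
  exists2 f, surjective_hyper_endomorphism f & surjective_from U f.

Definition admits_total X : Prop :=
  exists2 f, surjective_hyper_endomorphism f & total_into X f.

(* The endomorphisms witnessing that U and X are admissible may differ. *)
Definition minimum_U U : Prop :=
  admits_surjective U /\ forall U'', admits_surjective U'' -> #|U| <= #|U''|.

Definition minimum_X X : Prop :=
  admits_total X /\ forall X'', admits_total X'' -> #|X| <= #|X''|.

Definition UX_selection U X : Prop :=
  [/\ minimum_U U, minimum_X X &
      forall U'' X'', minimum_U U'' -> minimum_X X'' ->
        #|U'' :&: X''| <= #|U :&: X|].

End HyperEndomorphisms.

Arguments UX_selection {S} D U X.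

(* Main.v *)
Require Import Defs.
From mathcomp Require Import all_boot all_fingroup cyclic.
Set Implicit Arguments.
Unset Strict Implicit.
Unset Printing Implicit Defensive.

(** Composing hyper-endomorphisms and using minimality of cardinalities, every
    [U]-surjective [f] matches [U] with [U'] and every [X]-total [f] matches
    [X'] with [X].  For [U = U'] and [X = X'] the matchings are permutations, so
    some power [f] satisfies [f u :&: U = [set u]] on [U] and
    [f x :&: X = [set x]] on [X].  As [U :|: X] is the whole domain, each [z] in
    [U :&: X] has [f z = [set z]] and lies in no other [f y], whence
    [z \in U' :&: X'].  The pair [(U, X')] also consists of minimum sets, so
    maximality of [#|U :&: X|] gives [U :&: X' = U :&: X], which forces
    [X' \subset X]; likewise [U' \subset U]. *)

(** * Matchings forced by a cardinality bound *)

Section Matching.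
Variables (T : finType) (A B : {set T}) (r : rel T).

Definition choice_into (s : T -> T) :=
  forall a, a \in A -> (s a \in B) && r a (s a).

Hypothesis r_total : forall a, a \in A -> exists2 b, b \in B & r a b.
Hypothesis eq_card_AB : #|A| = #|B|.
(** The abstract trace of minimality: in both applications [s @: A] is again an admissible set,
    while [B] is one of least size. *)
Hypothesis choice_card : forall s, choice_into s -> #|B| <= #|s @: A|.

Lemma choice_into_exists : exists s, choice_into s.
Proof.
exists (fun a => odflt a [pick b in B | r a b]) => a aA.
case: pickP => [b //|none]; have [b bB rab] := r_total aA.
by have := none b; rewrite bB rab.
Qed.

Lemma choice_into_image s : choice_into s -> s @: A = B.
Proof.
move=> sP; apply/eqP; rewrite eqEcard choice_card // andbT.
by apply/subsetP => _ /imsetP[a aA ->]; case/andP: (sP a aA).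
Qed.

Lemma choice_into_inj s : choice_into s -> {in A &, injective s}.
Proof.
by move=> sP; apply/imset_injP; rewrite choice_into_image // eq_card_AB.
Qed.

Lemma choice_into_update s a b : choice_into s -> b \in B -> r a b ->
  choice_into [eta s with a |-> b].
Proof.
by move=> sP bB rab c cA /=; case: eqP => [->|_]; [rewrite bB rab | apply: sP].
Qed.

Lemma matching_onto b : b \in B -> exists2 a, a \in A & r a b.
Proof.
have [s sP] := choice_into_exists.
rewrite -(choice_into_image sP) => /imsetP[a aA ->].
by exists a => //; case/andP: (sP a aA).
Qed.

(** Redirect one choice function at [a] to [b1] and to [b2]. The first variant still covers [B], so
    it reaches [b2]; if it did so at some [c] other than [a], the second would send both [c] and [a]
    to [b2], against injectivity. *)
Lemma matching_functional a b1 b2 : a \in A -> b1 \in B -> b2 \in B ->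
  r a b1 -> r a b2 -> b1 = b2.
Proof.
move=> aA b1B b2B rab1 rab2; have [s sP] := choice_into_exists.
have s1P := choice_into_update sP b1B rab1.
have s2P := choice_into_update sP b2B rab2.
have: b2 \in [eta s with a |-> b1] @: A by rewrite choice_into_image.
case/imsetP => c cA /=; case: (eqVneq c a) => [_ -> //|neq_ca b2E].
have := choice_into_inj s2P cA aA; rewrite /= eqxx (negbTE neq_ca) -b2E.
by move=> /(_ erefl) eq_ca; rewrite eq_ca eqxx in neq_ca.
Qed.

End Matching.

Lemma matching_perm (T : finType) (A : {set T}) (r : rel T) :
  (forall a, a \in A -> exists2 b, b \in A & r a b) ->
  (forall s, choice_into A A r s -> #|A| <= #|s @: A|) ->
  exists p : {perm T}, choice_into A A r p.
Proof.
move=> r_total card_s; have [s sP] := choice_into_exists r_total.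
(* Extending by the identity off [A] gives a permutation of all of [T], so that its powers can be
   taken in a finite group. *)
pose s' x := if x \in A then s x else x.
have s_in x : x \in A -> s x \in A by case/sP/andP.
have inj_s' : injective s'.
  move=> x y; rewrite /s'.
  case: ifP => xA; case: ifP => yA // eq_s.
  - exact: (choice_into_inj (erefl _) card_s sP).
  - by rewrite -eq_s s_in in yA.
  - by rewrite eq_s s_in in xA.
by exists (perm inj_s') => a aA; rewrite permE /s' aA; apply: sP.
Qed.

(** * Composition and powers of hyper-endomorphisms *)

Section HyperEndomorphismTheory.
Variables (S : signature) (D : structure S).
Implicit Types (f g : D -> {set D}) (U X : {set D}).

Local Notation she := (@surjective_hyper_endomorphism S D).

Definition hyper_comp g f (d : D) : {set D} := hyper_image g (f d).

Lemma hyper_imageP g (A : {set D}) y :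
  reflect (exists2 a, a \in A & y \in g a) (y \in hyper_image g A).
Proof. exact: bigcupP. Qed.

Lemma hyper_imageS g (A B : {set D}) :
  A \subset B -> hyper_image g A \subset hyper_image g B.
Proof.
move=> /subsetP AB; apply/subsetP => y /hyper_imageP[a aA ya].
by apply/hyper_imageP; exists a; first exact: AB.
Qed.

Lemma hyper_image_comp g f (A : {set D}) :
  hyper_image (hyper_comp g f) A = hyper_image g (hyper_image f A).
Proof.
apply/setP => y; apply/hyper_imageP/hyper_imageP.
  case=> a aA /hyper_imageP[b bfa ygb].
  by exists b => //; apply/hyper_imageP; exists a.
case=> b /hyper_imageP[a aA bfa] ygb.
by exists a => //; apply/hyper_imageP; exists b.
Qed.

Lemma she_comp g f : she g -> she f -> she (hyper_comp g f).
Proof.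
move=> [[g0 gT] g_pres] [[f0 fT] f_pres]; split.
  split=> [d|]; last by rewrite hyper_image_comp fT.
  have /set0Pn[b bfd] := f0 d; have /set0Pn[c cgb] := g0 b.
  by apply/set0Pn; exists c; apply/hyper_imageP; exists b.
move=> R a c aR ac.
have mid j : {b | (b \in f (tnth a j)) && (tnth c j \in g b)}.
  apply: sigW; have /hyper_imageP[b bf cg] := ac j.
  by exists b; rewrite bf cg.
apply: (g_pres R [tuple sval (mid j) | j < arity R]) => [|j].
  apply: (f_pres R a) => // j; rewrite tnth_mktuple.
  by case/andP: (svalP (mid j)).
by rewrite tnth_mktuple; case/andP: (svalP (mid j)).
Qed.

Lemma surjective_from_comp g f U :
  she g -> surjective_from U f -> surjective_from U (hyper_comp g f).
Proof. by move=> [[_ gT] _] fU; rewrite /surjective_from hyper_image_comp fU. Qed.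

Lemma total_into_comp g f X :
  she f -> total_into X g -> total_into X (hyper_comp g f).
Proof.
move=> [[f0 _] _] gX d; have /set0Pn[b bfd] := f0 d.
have /set0Pn[x] := gX b; rewrite inE => /andP[xgb xX].
by apply/set0Pn; exists x; rewrite inE xX andbT; apply/hyper_imageP; exists b.
Qed.

(* [hyper_pow f n] is the composition power of exponent [n.+1]. *)
Definition hyper_pow f n := iter n (hyper_comp f) f.

Lemma she_pow f n : she f -> she (hyper_pow f n).
Proof. by move=> fH; elim: n => //= n IHn; apply: she_comp. Qed.

Lemma surjective_from_pow f n U :
  she f -> surjective_from U f -> surjective_from U (hyper_pow f n).
Proof. by move=> fH fU; elim: n => //= n IHn; apply: surjective_from_comp. Qed.

Lemma total_into_pow f n X :
  she f -> total_into X f -> total_into X (hyper_pow f n).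
Proof.
by move=> fH fX; case: n => //= n; apply: total_into_comp; first exact: she_pow.
Qed.

Lemma minimum_U_card U U' : minimum_U U -> minimum_U U' -> #|U| = #|U'|.
Proof.
by move=> [aU mU] [aU' mU']; apply/eqP; rewrite eqn_leq mU ?mU'.
Qed.

Lemma minimum_X_card X X' : minimum_X X -> minimum_X X' -> #|X| = #|X'|.
Proof.
by move=> [aX mX] [aX' mX']; apply/eqP; rewrite eqn_leq mX ?mX'.
Qed.

(** * Matching minimum sets for surjectivity *)

Section SurjectiveMatching.
Variables (f : D -> {set D}) (U U' : {set D}).
Hypotheses (fH : she f) (fU : surjective_from U f).
Hypotheses (mU : minimum_U U) (mU' : minimum_U U').

Let r : rel D := fun u' u => u' \in f u.

Lemma surjective_total u' : u' \in U' -> exists2 u, u \in U & r u' u.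
Proof. by move=> _; apply/hyper_imageP; rewrite fU inE. Qed.

(* If [s] picks [f]-preimages in [U] of the points of [U'], then composing [f]
   with a [U']-surjective map gives an [s @: U']-surjective one. *)
Lemma surjective_choice_card s : choice_into U' U r s -> #|U| <= #|s @: U'|.
Proof.
move=> sP; apply: mU.2; have [g gH gU'] := mU'.1.
exists (hyper_comp g f); first exact: she_comp.
apply/eqP; rewrite eqEsubset subsetT hyper_image_comp -gU' hyper_imageS //.
apply/subsetP => u' u'U'; apply/hyper_imageP; exists (s u').
  exact: imset_f.
by case/andP: (sP u' u'U').
Qed.

Lemma surjective_meets u : u \in U -> exists2 u', u' \in U' & u' \in f u.
Proof. exact: (matching_onto surjective_total surjective_choice_card). Qed.

Lemma surjective_functional u' u1 u2 : u' \in U' -> u1 \in U -> u2 \in U ->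
  u' \in f u1 -> u' \in f u2 -> u1 = u2.
Proof.
exact: (matching_functional surjective_total (minimum_U_card mU' mU)
          surjective_choice_card).
Qed.

End SurjectiveMatching.

(** * Matching minimum sets for totality *)

Section TotalMatching.
Variables (f : D -> {set D}) (X X' : {set D}).
Hypotheses (fH : she f) (fX : total_into X f).
Hypotheses (mX : minimum_X X) (mX' : minimum_X X').

Let r : rel D := fun x' x => x \in f x'.

Lemma total_total x' : x' \in X' -> exists2 x, x \in X & r x' x.
Proof.
move=> _; have /set0Pn[x] := fX x'.
by rewrite inE => /andP[xf xX]; exists x.
Qed.

(* Composing an [X']-total map with [f] gives an [s @: X']-total one. *)
Lemma total_choice_card s : choice_into X' X r s -> #|X| <= #|s @: X'|.
Proof.
move=> sP; apply: mX.2; have [g gH gX'] := mX'.1.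
exists (hyper_comp f g); first exact: she_comp.
move=> d; have /set0Pn[x'] := gX' d; rewrite inE => /andP[x'g x'X'].
apply/set0Pn; exists (s x'); rewrite inE imset_f // andbT.
by apply/hyper_imageP; exists x' => //; case/andP: (sP x' x'X').
Qed.

Lemma total_covered x : x \in X -> exists2 x', x' \in X' & x \in f x'.
Proof. exact: (matching_onto total_total total_choice_card). Qed.

Lemma total_functional x' x1 x2 : x' \in X' -> x1 \in X -> x2 \in X ->
  x1 \in f x' -> x2 \in f x' -> x1 = x2.
Proof.
exact: (matching_functional total_total (minimum_X_card mX' mX)
          total_choice_card).
Qed.

End TotalMatching.

Lemma reflexive_she_exists U X : minimum_U U -> minimum_X X ->
  exists f, [/\ she f, surjective_from U f, total_into X f,
    {in U, forall u, u \in f u} & {in X, forall x, x \in f x}].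
Proof.
move=> mU mX; have [[g gH gU] _] := mU; have [[h hH hX] _] := mX.
(* Surjectivity from [U] is inherited from the inner factor, totality into [X] from the outer
   one. *)
pose f := hyper_comp h g.
have fH : she f by apply: she_comp.
have fU : surjective_from U f by apply: surjective_from_comp.
have fX : total_into X f by apply: total_into_comp.
have [p pP] := matching_perm (surjective_total (U' := U) fU)
  (surjective_choice_card fH mU mU).
have [q qP] := matching_perm (total_total (X' := X) fX)
  (total_choice_card fH mX mX).
(* The order of the symmetric group kills [p] and [q] at once; the exponent [N] is written [N.-1] in
   [hyper_pow]. *)
pose N := #|[set: {perm D}]|.
have perm_N (t : {perm D}) x : iter N.-1.+1 t x = x.
  by rewrite prednK ?cardG_gt0 // -permX expg_cardG ?inE // perm1.
exists (hyper_pow f N.-1); split.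
- exact: she_pow.
- exact: surjective_from_pow.
- exact: total_into_pow.
(* [p] runs against [f], as [u \in f (p u)], whereas [q] below runs along it, as [q x \in f x]. *)
- have powU n : {in U, forall u, u \in hyper_pow f n (iter n.+1 p u)}.
    elim: n => [|n IHn] u uU; first by case/andP: (pP u uU).
    have /andP[puU upu] := pP u uU.
    by apply/hyper_imageP; exists (p u) => //; rewrite iterSr; apply: IHn.
  by move=> u uU; have := powU N.-1 u uU; rewrite perm_N.
- have powX n : {in X, forall x,
      (iter n.+1 q x \in X) && (iter n.+1 q x \in hyper_pow f n x)}.
    elim: n => [|n IHn] x xX; first exact: qP.
    have /andP[yX yf] := IHn x xX; have /andP[-> qyf] := qP _ yX.
    by apply/hyper_imageP; exists (iter n.+1 q x).
  by move=> x xX; have /andP[_] := powX N.-1 x xX; rewrite perm_N.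
Qed.

Lemma minimum_setI_sub U X U' X' :
  minimum_U U -> minimum_X X -> U :|: X = [set: D] ->
  minimum_U U' -> minimum_X X' -> U :&: X \subset U' :&: X'.
Proof.
move=> mU mX UX mU' mX'.
have [f [fH fU fX reflU reflX]] := reflexive_she_exists mU mX.
have UorX y : y \in U \/ y \in X by apply/orP; rewrite -in_setU UX inE.
have funcU := surjective_functional fH fU mU mU.
have funcX := total_functional fH fX mX mX.
apply/subsetP => z; rewrite !inE => /andP[zU zX]; apply/andP; split.
  have [y yU' yfz] := surjective_meets fH fU mU mU' zU.
  suff -> : z = y by [].
  (* For [y] in [U], [y] lies in both [f z] and [f y]; for [y] in [X], both [z] and [y] lie in
     [f z]. *)
  case: (UorX y) => [yU|yX]; first by apply: (funcU y) => //; apply: reflU.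
  by apply: (funcX z) => //; apply: reflX.
have [y yX' zfy] := total_covered fH fX mX mX' zX.
suff -> : z = y by [].
case: (UorX y) => [yU|yX]; first by apply: (funcU z) => //; apply: reflU.
by apply: (funcX y) => //; apply: reflX.
Qed.

End HyperEndomorphismTheory.

Theorem theorem13 (S : signature) (D : structure S) (U X U' X' : {set D}) :
  UX_selection D U X -> U :|: X = [set: D] ->
  UX_selection D U' X' -> U' :|: X' = [set: D] ->
  U = U' /\ X = X'.
Proof.
move=> [mU mX maxUX] UX [mU' mX' _] _.
have /subsetP sub := minimum_setI_sub mU mX UX mU' mX'.
have UorX y : (y \in U) || (y \in X) by rewrite -in_setU UX inE.
(* The inclusion comes from [sub], the bound on cardinalities from maximality against the mixed pair
   [(U, X')]. *)
have eqX : U :&: X = U :&: X'.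
  apply/eqP; rewrite eqEcard maxUX // andbT.
  apply/subsetP => z zI; have := sub z zI.
  by move: zI; rewrite !inE => /andP[-> _] /andP[].
have eqU : U :&: X = U' :&: X.
  apply/eqP; rewrite eqEcard maxUX // andbT.
  apply/subsetP => z zI; have := sub z zI.
  by move: zI; rewrite !inE => /andP[_ ->] /andP[->].
(* A point of [U'] outside [U] would lie in [X], hence in [U' :&: X = U :&: X], a contradiction;
   similarly for [X']. *)
split; apply/esym/eqP; rewrite eqEcard.
  rewrite (minimum_U_card mU mU') leqnn andbT; apply/subsetP => y yU'.
  have /setP/(_ y) := eqU; have := UorX y; rewrite !inE yU'.
  by do 2!case: (y \in _).
rewrite (minimum_X_card mX mX') leqnn andbT; apply/subsetP => y yX'.
have /setP/(_ y) := eqX; have := UorX y; rewrite !inE yX'.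
by do 2!case: (y \in _).
Qed.
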